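(* Let $m\ge1$, $\varepsilon\in\{0,1\}$ with $2m+\varepsilon\ge 3$, and let $n$ be an integer with $m+2\le n\le 2m+\varepsilon+1$. Let $Z^{\varepsilon}_{m,n}$ be the smooth projective toric $(2m+\varepsilon)$-fold defined in the context. (i) For $\varepsilon=0$ and $m\ge 2$, $$\bigl(\tau_{Z^0_{m,n}}(\mathbb Z),\tau_{Z^0_{m,n}}(\mathbb Q)\bigr)=\Bigl(2,\frac{2m+1}{m}\Bigr),\qquad \delta(Z^0_{m,n})=\frac1m.$$ (ii) For $\varepsilon=1$, $$\bigl(\tau_{Z^1_{m,n}}(\mathbb Z),\tau_{Z^1_{m,n}}(\mathbb Q)\bigr)=(2,2),\qquad \delta(Z^1_{m,n})=0.$$
   Context: All toric varieties are over an algebraically closed field. Gongyo indices. For a smooth projective toric variety $X$, a nonzero class $D\in\mathrm{Nef}(X)\cap\mathrm{Pic}(X)$ and $\mathbb K\in\{\mathbb Z,\mathbb Q\}$, put $$\tau_X(D;\mathbb K)=\sup\Big\{\sum_{i=1}^r a_i\ \Big|\ D=\sum_{i=1}^r a_iD_i,\ 0\ne D_i\in\mathrm{Nef}(X)\cap\mathrm{Pic}(X),\ a_i\in\mathbb K_{>0}\Big\}$$ (for $\mathbb K=\mathbb Q$ the equality is in $\mathrm{Pic}(X)\otimes\mathbb Q$), and $\delta_X(D)=\tau_X(D;\mathbb Q)-\tau_X(D;\mathbb Z)$. If $-K_X$ is nef and nonzero, $\tau_X(\mathbb K):=\tau_X(-K_X;\mathbb K)$ and $\delta(X):=\delta_X(-K_X)$.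 A primitive collection of a smooth complete fan is a set of primitive ray generators that does not span a cone although every proper subset does; a set of ray generators spans a cone iff it contains no primitive collection. The models $Z^\varepsilon_{m,n}$. Let $d=2m+\varepsilon\ge3$ and $m+1\le n\le 2m+\varepsilon+1$. Let $N\simeq\mathbb Z^d$ and $x_1,\dots,x_{d+1}\in N$ with $x_1,\dots,x_d$ a basis and $x_1+\cdots+x_{d+1}=0$; put $y_i=-x_i$ for $1\le i\le n$. $Z^\varepsilon_{m,n}$ is the smooth projective toric $d$-fold whose fan has primitive ray generators $x_1,\dots,x_{d+1},y_1,\dots,y_n$ and whose primitive collections are exactly the left-hand sides of the following primitive relations: $x_i+y_i=0$ ($1\le i\le n$); $\sum_{j\notin I}x_j=\sum_{i\in I}y_i$ for $I\subset\{1,\dots,n\}$, $|I|=m$; $\sum_{j\in J}y_j=\sum_{\ell\notin J}x_\ell$ for $J\subset\{1,\dots,n\}$, $|J|=m+1$; complements being taken in $\{1,\dots,2m+\varepsilon+1\}$. (It is Fano for $\varepsilon=0$ and weak Fano for $\varepsilon=1$.) *)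

(* Defs.v *)
From HB Require Import structures.
From mathcomp Require Import classical_sets reals constructive_ereal ereal.
From mathcomp Require Import all_boot all_order all_algebra.
From mathcomp Require Import ring lra zify.

Set Implicit Arguments.
Unset Strict Implicit.
Unset Printing Implicit Defensive.

Import Order.TTheory GRing.Theory Num.Theory.
Local Open Scope ring_scope.

(* A simplicial collection of cones in [N = Z^d]: a cone is recorded by the set
   of its rays.  That such data really are the fan of a smooth projective
   toric variety is the predicate [smooth_projective] below. *)
Record fan (d : nat) := Fan {
  ray : finType;
  gen : ray -> 'rV[int]_d;
  cones : {set {set ray}}
}.
Arguments gen {d} f _.
Arguments cones {d} f.

Section Fan.
Variables (d : nat) (X : fan d).
Implicit Types (s t P : {set ray X}).

Definition pairing (K : pzRingType) (u : 'rV[K]_d) (v : 'rV[int]_d) : K :=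
  \sum_k u 0 k * (v 0 k)%:~R.

Definition in_cone s (w : 'rV[rat]_d) : Prop :=
  exists a : ray X -> rat,
    [/\ forall r, 0 <= a r, forall r, r \notin s -> a r = 0 &
        w = \sum_r a r *: map_mx intr (gen X r)].

Definition maxcone s : bool := (s \in cones X) && (#|s| == d).

Definition primitive_collection P : bool :=
  (P \notin cones X) && [forall s : {set ray X}, (s \proper P) ==> (s \in cones X)].

(* A torus-invariant curve is [V(s :&: t)] for maximal cones [s], [t] meeting
   in a wall.  Its class is recorded by the intersection numbers
   [b r = (D_r . V(s :&: t))]: by smoothness these are the coefficients of the
   wall relation, normalised to be 1 on the two rays off the wall. *)
Definition wall s t : bool :=
  [&& maxcone s, maxcone t & #|s :&: t|.+1 == d].

Definition invariant_curve (b : {ffun ray X -> int}) : Prop :=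
  exists s t, [/\ wall s t,
    forall r, r \notin s :|: t -> b r = 0,
    forall r, r \in (s :|: t) :\: (s :&: t) -> b r = 1 &
    \sum_r b r *: gen X r = 0].

(* [D] stands for the divisor [\sum_r D r * D_r], [D_r] the divisor of [r]. *)
Definition divisor := {ffun ray X -> int}.

Definition intersection (D : divisor) (b : {ffun ray X -> int}) : int :=
  \sum_r D r * b r.

(* By the toric cone theorem the torus-invariant curves generate the cone of
   all curves, so testing on them is testing on every curve. *)
Definition nef (D : divisor) : Prop :=
  forall b, invariant_curve b -> 0 <= intersection D b.

Definition ample (D : divisor) : Prop :=
  forall b, invariant_curve b -> 0 < intersection D b.

(* Linear equivalence with coefficients in [K]: [Pic X] is the set of divisors
   modulo [lin_equiv int], and equality in [Pic X (x) K] is [lin_equiv K]. *)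
Definition lin_equiv (K : pzRingType) (D E : {ffun ray X -> K}) : Prop :=
  exists u : 'rV[K]_d, forall r, D r - E r = pairing u (gen X r).

Definition scalar_ext (K : pzRingType) (D : divisor) : {ffun ray X -> K} :=
  [ffun r => (D r)%:~R].

Definition anticanonical : divisor := [ffun => 1].

Record smooth_projective : Prop := SmoothProjective {
  sp_ray : forall r, [set r] \in cones X;
  sp_face : forall s t, t \in cones X -> s \subset t -> s \in cones X;
  sp_smooth : forall s, s \in cones X ->
    exists (B : 'M[int]_d) (f : ray X -> 'I_d),
      [/\ B \in unitmx, {in s &, injective f} &
          {in s, forall r, row (f r) B = gen X r}];
  sp_meet : forall s t w, s \in cones X -> t \in cones X ->
    in_cone s w -> in_cone t w -> in_cone (s :&: t) w;
  sp_complete : forall w, exists2 s, s \in cones X & in_cone s w;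
  sp_projective : exists D, ample D
}.

Definition nef_decomposition (K : numDomainType) (D : divisor) (c : K) : Prop :=
  exists (l : nat) (a : 'I_l -> K) (E : 'I_l -> divisor),
    [/\ forall i, 0 < a i,
        forall i, nef (E i) /\ ~ lin_equiv (E i) 0,
        lin_equiv (scalar_ext K D) [ffun r => \sum_i a i * scalar_ext K (E i) r] &
        c = \sum_i a i].

Local Open Scope classical_set_scope.

Definition tauZ (R : realType) (D : divisor) : \bar R :=
  ereal_sup [set (c%:~R)%:E | c in [set c : int | nef_decomposition D c]].

Definition tauQ (R : realType) (D : divisor) : \bar R :=
  ereal_sup [set (ratr c)%:E | c in [set c : rat | nef_decomposition D c]].

Definition delta (R : realType) (D : divisor) : \bar R :=
  (tauQ R D - tauZ R D)%E.

End Fan.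

Section Models.
Variables (e : bool) (m n : nat).
Let d := (2 * m + e)%N.

(* Indices are shifted down by one: [x_0, ..., x_(d-1)] is the standard basis
   and [x_d = - (x_0 + ... + x_(d-1))]; [y_i = - x_i] for [i < n]. *)
Definition xvec (j : 'I_d.+1) : 'rV[int]_d :=
  \row_(k < d) ((j == k :> nat)%:R - (j == d :> nat)%:R).

Definition yidx := {i : 'I_d.+1 | (i < n)%N}.

Definition Zray : finType := ('I_d.+1 + yidx)%type.

Definition Zgen (r : Zray) : 'rV[int]_d :=
  match r with inl j => xvec j | inr i => - xvec (val i) end.

Definition xset (A : {set 'I_d.+1}) : {set Zray} := [set inl j | j in A].
Definition yset (A : {set yidx}) : {set Zray} := [set inr i | i in A].

Definition compl (A : {set yidx}) : {set 'I_d.+1} := ~: [set val i | i in A].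

Definition Zprim : {set {set Zray}} :=
  [set [set inl (val i); inr i] | i : yidx]
  :|: [set xset (compl I) | I : {set yidx} & #|I| == m]
  :|: [set yset J | J : {set yidx} & #|J| == m.+1].

(* A set of rays spans a cone iff it contains no primitive collection; see
   [Zfan_smooth_projective], [Zfan_primitive_collections] and
   [Zfan_primitive_relations] below. *)
Definition Zfan : fan d :=
  Fan Zgen [set s : {set Zray} | ~~ [exists P in Zprim, P \subset s]].

End Models.

Lemma ample_x (M P Q E : int) :
  P + Q = 2 * M + E -> Q <= M -> 0 < M -> 0 <= E ->
  0 < 2 * M + (2 * M * P - (2 * M + 1) * Q).
Proof.
move=> pq qM M0 E0; have -> : P = 2 * M + E - Q by rewrite -pq addrK.
have : 0 <= (4 * M + 1) * (M - Q) by apply: mulr_ge0; lia.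
have : 0 <= M * E by apply: mulr_ge0 => //; apply: ltW.
lia.
Qed.

Lemma ample_y (M P Q E : int) :
  P + Q = 2 * M + E -> Q = M -> 0 < M -> E <= 1 ->
  0 < 2 * M + 1 - (2 * M * P - (2 * M + 1) * Q).
Proof.
move=> pq qM M0 E1; subst Q; have -> : P = 2 * M + E - M by rewrite -pq addrK.
have : 0 <= M * (1 - E) by apply: mulr_ge0; lia.
lia.
Qed.

Section Facts.
Variables (e : bool) (m n : nat).
Hypotheses (hm : (1 <= m)%N) (hn : (m + 1 <= n <= 2 * m + e + 1)%N).
Local Notation d := (2 * m + e)%N.
Local Notation Z := (Zfan e m n).
Local Notation yidx := (yidx e m n).
Implicit Types (s t : {set ray Z}) (j k : 'I_d.+1).

Let px s : {set 'I_d.+1} := [set j | inl j \in s].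
Let qy s : {set 'I_d.+1} := [set val i | i : yidx & inr i \in s].

Lemma sub_pick (T : finType) (A : {set T}) c :
  (c <= #|A|)%N -> exists2 B : {set T}, B \subset A & #|B| = c.
Proof.
move=> hc; exists [set i in take c (enum A)].
  by apply/subsetP=> i; rewrite inE => /mem_take; rewrite mem_enum.
rewrite cardsE (card_uniqP _) ?take_uniq ?enum_uniq // size_takel //.
by rewrite -cardE.
Qed.

Lemma card_ylt : #|[set j : 'I_d.+1 | (j < n)%N]| = n.
Proof.
have hnd : (n <= d.+1)%N by lia.
rewrite -[RHS]card_ord -cardsT -(card_imset setT (f := widen_ord hnd)).
  congr #|pred_of_set _|; apply/setP=> j; rewrite inE; apply/idP/imsetP.
    by move=> hj; exists (Ordinal hj) => //; apply: val_inj.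
  by case=> i _ ->; rewrite /= ltn_ord.
by move=> i k /(congr1 val) /= /val_inj.
Qed.

Lemma qyE s j (hj : (j < n)%N) : (j \in qy s) = (inr (exist _ j hj : yidx) \in s).
Proof.
apply/imsetP/idP => [[i]|h]; last by exists (exist _ j hj); rewrite ?inE.
rewrite inE => hi ji; suff -> : exist _ j hj = i :> yidx by [].
exact: val_inj.
Qed.

Lemma qy_lt s j : j \in qy s -> (j < n)%N.
Proof. by case/imsetP=> i _ ->; apply: (valP i). Qed.

Lemma coneP s : reflect
  [/\ [disjoint px s & qy s], (#|qy s| <= m)%N &
      (forall j, j \notin px s -> (j < n)%N) -> (m < #|~: px s|)%N]
  (s \in cones Z).
Proof.
have cI (A : {set yidx}) : #|[set val i | i in A]| = #|A|.
  by apply: card_imset; apply: val_inj.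
rewrite inE; apply: (iffP idP) => [/exists_inPn h|[h1 h2 h3]].
  split.
  - rewrite -setI_eq0; apply/eqP/setP=> j; rewrite in_set0; apply/negP.
    rewrite inE => /andP[jp jq]; have hj := qy_lt jq.
    rewrite (qyE s hj) in jq; rewrite inE in jp.
    have hP : [set inl j; inr (exist _ j hj : yidx)] \in Zprim e m n.
      rewrite /Zprim 2!inE; apply/orP; left; apply/orP; left; apply/imsetP.
      by exists (exist _ j hj).
    by have := h _ hP; rewrite subUset !sub1set jp jq.
  - rewrite leqNgt cI; apply/negP => hq.
    have [J Js cJ] := sub_pick hq.
    have hP : yset J \in Zprim e m n.
      rewrite /Zprim 2!inE; apply/orP; right; apply/imsetP.
      by exists J; rewrite ?inE ?cJ.
    have /negP[] := h _ hP; apply/subsetP => r /imsetP[i iJ ->].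
    by have /subsetP/(_ _ iJ) := Js; rewrite inE.
  - move=> hp; rewrite ltnNge; apply/negP => hc.
    pose A : {set yidx} := [set i | val i \notin px s].
    have cA : (#|A| <= m)%N.
      rewrite -cI; apply: leq_trans hc; apply: subset_leq_card.
      by apply/subsetP => j /imsetP[i]; rewrite inE => hi ->; rewrite in_setC.
    have : (m - #|A| <= #|~: A|)%N.
      have := cardsC A; have := cI setT.
      have -> : [set val i | i in [set: yidx]] = [set j : 'I_d.+1 | (j < n)%N].
        apply/setP=> j; rewrite inE; apply/imsetP/idP => [[i _ ->]|hj].
          exact: (valP i).
        by exists (exist _ j hj).
      rewrite card_ylt cardsT; move=> h4 h5; rewrite -h5 in h4; clear -h4 hn; move: #|A| #|~: A| h4 => a b h4; lia.
    case/sub_pick=> B BA cB.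
    have dAB : A :&: B = set0.
      by apply/eqP; rewrite setI_eq0 disjoint_sym -[A]setCK -subsets_disjoint.
    have hP : xset n (compl (A :|: B)) \in Zprim e m n.
      rewrite /Zprim 2!inE; apply/orP; left; apply/orP; right; apply/imsetP.
      exists (A :|: B) => //.
      by rewrite inE cardsU dAB cards0 subn0 cB subnKC.
    have /negP[] := h _ hP; apply/subsetP => r /imsetP[j]; rewrite inE => jAB ->.
    apply: contraR jAB => js; have jp : j \notin px s by rewrite inE.
    apply/imsetP; exists (exist _ j (hp _ jp)) => //.
    by rewrite 2!inE /= jp.
apply/exists_inPn => P; rewrite /Zprim 2!inE -orbA; case/or3P => /imsetP.
- case=> i _ ->; apply/negP; rewrite subUset !sub1set => /andP[h4 h5].
  have /pred0P/(_ (val i)) := h1; rewrite /= [val i \in px s]inE h4 /=.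
  by move/negP; apply; apply/imsetP; exists i; rewrite ?inE.
- case=> I; rewrite inE => /eqP cA ->; apply/negP => /subsetP hs.
  have hp : ~: px s \subset [set val i | i in I].
    apply/subsetP => j; rewrite inE; apply: contraR => hj.
    by rewrite inE; apply: hs; apply: imset_f; rewrite inE.
  have : (m < #|~: px s|)%N.
    apply: h3 => j hj.
    have /subsetP/(_ j) := hp; rewrite inE hj => /(_ isT)/imsetP[i _ ->].
    exact: (valP i).
  by rewrite ltnNge -[X in (_ <= X)%N]cA -(cI I) subset_leq_card.
- case=> J; rewrite inE => /eqP cJ ->; apply/negP => /subsetP hs.
  have : (#|[set val i | i in J]| <= #|qy s|)%N.
    apply: subset_leq_card; apply/subsetP => j /imsetP[i iJ ->].
    by apply/imsetP; exists i; rewrite // inE; apply/hs/imset_f.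
  by rewrite cI cJ; lia.
Qed.

Lemma pairing_xvec (K : pzRingType) (c : 'I_d.+1 -> K) j :
  \sum_i c i = 0 ->
  pairing (\row_k c (widen_ord (leqnSn d) k)) (xvec j) = c j.
Proof.
rewrite big_ord_recr /= => c0; rewrite /pairing.
under eq_bigr => k _ do rewrite !mxE.
have [hj|hj] := ltnP j d.
  have -> : (j == d :> nat) = false by apply/negbTE; rewrite neq_ltn hj.
  have jE : widen_ord (leqnSn d) (Ordinal hj) = j by apply: val_inj.
  rewrite (bigD1 (Ordinal hj)) //= jE eqxx subr0 mulr1 big1 ?addr0 // => k kj.
  suff -> : (j == k :> nat) = false by rewrite subr0 mulr0.
  by apply/negbTE; apply: contra kj => /eqP kj; apply/eqP/val_inj.
have jE : j = ord_max by apply: val_inj => /=; have := ltn_ord j; lia.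
rewrite jE /= eqxx -[RHS](addKr (\sum_(i < d) c (widen_ord (leqnSn d) i))).
rewrite c0 addr0 -sumrN; apply: eq_bigr => k _.
have -> : (d == k :> nat) = false by apply/negbTE; rewrite neq_ltn ltn_ord orbT.
by rewrite sub0r mulrN1.
Qed.

Lemma xvec_coord (z : 'I_d.+1 -> rat) (k : 'I_d) :
  (\sum_j z j *: map_mx intr (xvec j)) 0 k
  = z (widen_ord (leqnSn d) k) - z ord_max.
Proof.
rewrite summxE; under eq_bigr => j _ do rewrite !mxE rmorphB mulrBr !rmorph_nat.
rewrite sumrB; congr (_ - _).
  rewrite (bigD1 (widen_ord (leqnSn d) k)) //= eqxx mulr1 big1 ?addr0 // => j jk.
  suff -> : (j == k :> nat) = false by rewrite mulr0.
  by apply/negbTE; apply: contra jk => /eqP jk; apply/eqP/val_inj.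
rewrite (bigD1 ord_max) //= eqxx mulr1 big1 ?addr0 // => j jk.
suff -> : (j == d :> nat) = false by rewrite mulr0.
by apply/negbTE; apply: contra jk => /eqP jk; apply/eqP/val_inj.
Qed.

Let ysum (a : ray Z -> rat) j := \sum_(i : yidx | val i == j) a (inr i).
Let zc (a : ray Z -> rat) j := a (inl j) - ysum a j.

Lemma ysumE (a : ray Z -> rat) j (hj : (j < n)%N) :
  ysum a j = a (inr (exist _ j hj : yidx)).
Proof. by rewrite /ysum (big_pred1 (exist _ j hj : yidx)). Qed.

Lemma ysum_ge0 (a : ray Z -> rat) j : (forall r, 0 <= a r) -> 0 <= ysum a j.
Proof. by move=> a0; apply: sumr_ge0. Qed.

Lemma ysum_eq0 s (a : ray Z -> rat) j :
  (forall r, r \notin s -> a r = 0) -> j \notin qy s -> ysum a j = 0.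
Proof.
move=> a0 jq; apply: big1 => i /eqP ij; apply: a0.
by apply: contra jq => iq; apply/imsetP; exists i; rewrite ?inE.
Qed.

Lemma comb_zc (a : ray Z -> rat) :
  \sum_r a r *: map_mx intr (gen Z r) = \sum_j zc a j *: map_mx intr (xvec j).
Proof.
rewrite big_sumType /=.
under [RHS]eq_bigr => j _ do rewrite scalerBl.
rewrite sumrB; congr (_ + _).
rewrite -sumrN (partition_big (fun i : yidx => val i) predT) //=.
apply: eq_bigr => j _; rewrite /ysum scaler_suml -sumrN.
by apply: eq_bigr => i /eqP <-; rewrite map_mxN scalerN.
Qed.

Lemma zc_shift (a a' : ray Z -> rat) :
  \sum_r a r *: map_mx intr (gen Z r) = \sum_r a' r *: map_mx intr (gen Z r) ->
  exists c, forall j, zc a j = zc a' j + c.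
Proof.
rewrite !comb_zc => h; exists (zc a ord_max - zc a' ord_max) => j.
have [->|hj] := eqVneq j ord_max; first by rewrite addrC subrK.
have jd : (j < d)%N.
  by rewrite ltn_neqAle -ltnS ltn_ord andbT.
have jE : widen_ord (leqnSn d) (Ordinal jd) = j by apply: val_inj.
move/(congr1 (fun w : 'rV[rat]_d => w 0 (Ordinal jd))): h.
rewrite !xvec_coord jE => h; lra.
Qed.

Lemma Zfan_ray r : [set r] \in cones Z.
Proof.
apply/coneP; case: r => [j|i].
  have -> : qy [set inl j] = set0.
    by apply/setP=> k; rewrite inE; apply/imsetP => -[i]; rewrite !inE.
  have -> : px [set inl j] = [set j].
    by apply/setP=> k; rewrite !inE.
  rewrite disjoint_sym disjoints_subset sub0set cards0; split => //.
  by rewrite cardsC1 card_ord => _; lia.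
have -> : px [set inr i] = set0 by apply/setP=> k; rewrite !inE.
have -> : qy [set inr i] = [set val i].
  apply/setP=> k; rewrite inE; apply/imsetP/eqP.
    by case=> i'; rewrite !inE => /eqP [->].
  by move->; exists i; rewrite ?inE.
rewrite disjoints_subset sub0set cards1; split => //.
by rewrite setC0 cardsT card_ord; lia.
Qed.

Lemma Zfan_face s t : t \in cones Z -> s \subset t -> s \in cones Z.
Proof.
rewrite !inE => /exists_inPn ht st; apply/exists_inPn => P /ht.
by apply: contra => /subset_trans; apply.
Qed.

Lemma cone_omits s : s \in cones Z -> exists k, k \notin px s :|: qy s.
Proof.
case/coneP => _ hq hp; apply/existsP; apply: contraLR hq.
rewrite negb_exists => /forallP h; rewrite -ltnNge.
have pq : ~: px s \subset qy s.
  apply/subsetP=> j; rewrite in_setC => jp; have := h j.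
  by rewrite negbK in_setU (negbTE jp).
apply: leq_trans (subset_leq_card pq); apply: hp => j jp.
by apply: (@qy_lt s); apply: (subsetP pq); rewrite in_setC.
Qed.

Lemma Zfan_meet s t w : s \in cones Z -> t \in cones Z ->
  in_cone s w -> in_cone t w -> in_cone (s :&: t) w.
Proof.
have key s' t' (a a' : ray Z -> rat) c : s' \in cones Z -> t' \in cones Z ->
    (forall r, 0 <= a r) -> (forall r, r \notin s' -> a r = 0) ->
    (forall r, 0 <= a' r) -> (forall r, r \notin t' -> a' r = 0) ->
    (forall j, zc a j = zc a' j + c) -> c <= 0.
  move=> /coneP[_ _ hp] /coneP[_ hq _] a0 as0 a'0 at0 h; rewrite leNgt.
  apply/negP => c0; have pq : ~: px s' \subset qy t'.
    apply/subsetP=> j; rewrite !inE => js; apply/negPn/negP => jq.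
    have := h j; rewrite /zc (as0 _ js) (ysum_eq0 at0 jq).
    have := ysum_ge0 j a0; have := a'0 (inl j); lra.
  have := leq_trans (subset_leq_card pq) hq; rewrite leqNgt hp // => j jp.
  by apply: (@qy_lt t'); apply: (subsetP pq); rewrite in_setC.
move=> hs ht [a [a0 as0 wa]] [a' [a'0 at0 wa']].
have [c hc] : exists c, forall j, zc a j = zc a' j + c.
  by apply: zc_shift; rewrite -wa -wa'.
have c0 : c = 0.
  apply/eqP; rewrite eq_le (key s t a a' c) //=.
  have := key t s a' a (- c) ht hs a'0 at0 a0 as0; rewrite oppr_le0; apply.
  by move=> j; rewrite hc addrK.
exists a; split => // r; rewrite inE negb_and.
have [rs /= rt|/as0 //] := boolP (r \in s).
have /coneP[/pred0P dpq _ _] := hs.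
case: r rs rt => [j|i] rs rt.
  have jq : j \notin qy s by have := dpq j; rewrite /= inE rs /= => ->.
  have := hc j; rewrite c0 /zc (at0 _ rt) (ysum_eq0 as0 jq).
  have := ysum_ge0 j a'0; have := a0 (inl j); lra.
have iE : exist _ (val i) (valP i) = i :> yidx by apply: val_inj.
have iq : val i \in qy s by rewrite (qyE s (valP i)) iE.
have ip : inl (val i) \notin s.
  by have := dpq (val i); rewrite /= iq andbT inE => ->.
have := hc (val i); rewrite c0 /zc !(ysumE _ (valP i)) iE (as0 _ ip) (at0 _ rt).
have := a'0 (inl (val i)); have := a0 (inr i); lra.
Qed.

Lemma Zfan_complete w : exists2 s, s \in cones Z & in_cone s w.
Proof.
pose c j : rat := if insub (val j) is Some k then w 0 (k : 'I_d) else 0.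
have wE u : w = \sum_j (c j - u) *: map_mx intr (xvec j).
  apply/rowP => k; rewrite xvec_coord /c /= insubT //= => hk.
  rewrite insubF ?ltnn //; set k' := Sub _ _; have -> : k' = k by apply: val_inj.
  by rewrite opprB addrCA subrr addr0 sub0r opprK addrC addKr || ring.
pose low u : {set 'I_d.+1} := [set j | c j < u].
pose good j := [forall i in low (c j), (i < n)%N] && (#|low (c j)| <= m)%N.
have good0 : good [arg min_(j < ord_max) c j]%O.
  case: arg_minP => // j _ hj; have -> : good j = true; last by [].
  have l0 : low (c j) = set0.
    by apply/setP=> i; rewrite !inE ltNge hj.
  by rewrite /good l0 cards0 andbT; apply/forall_inP => i; rewrite inE.
case: (arg_maxP c good0) => k /andP[/forall_inP klt kc] kmax.
set u := c k in klt kc kmax.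
pose z j := c j - u.
pose a (r : ray Z) : rat :=
  match r with inl j => Num.max (z j) 0 | inr i => Num.max (- z (val i)) 0 end.
have a0 r : 0 <= a r by case: r => [j|i] /=; rewrite le_max lexx orbT.
pose s : {set ray Z} := [set r | 0 < a r].
exists s; last first.
  exists a; split => // [r|].
    by rewrite inE lt_neqAle a0 andbT negbK => /eqP.
  rewrite comb_zc (wE u); apply: eq_bigr => j _; congr (_ *: _).
  rewrite /zc -/(z j) /=.
  have [hj|hj] := ltnP j n.
    rewrite ysumE /=; case: (leP (z j) 0) => h; case: (leP (- z j) 0); lra.
  have -> : ysum a j = 0.
    apply: big1 => i /eqP ij; have := valP i; rewrite /= ij; lia.
  rewrite subr0; apply/esym/max_idPl; rewrite subr_ge0 leNgt; apply/negP => jk.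
  by have := klt j; rewrite inE jk => /(_ isT); rewrite ltnNge hj.
have pxE j : (j \in px s) = (u < c j).
  by rewrite !inE /= lt_max ltxx orbF subr_gt0.
have qylow : qy s \subset low u.
  apply/subsetP => j /imsetP[i]; rewrite !inE /= lt_max ltxx orbF => h ->.
  by move: h; rewrite oppr_gt0 subr_lt0.
apply/coneP; split.
- rewrite disjoint_sym disjoints_subset (subset_trans qylow) //.
  by apply/subsetP => j; rewrite in_setC pxE inE -leNgt => /ltW.
- exact: leq_trans (subset_leq_card qylow) kc.
move=> hp; rewrite ltnNge; apply/negP => hc.
have [j0 j0p] : exists j0, j0 \in px s.
  apply/existsP; apply: contraLR hc; rewrite negb_exists => /forallP h.
  have -> : ~: px s = setT by apply/setP => j; rewrite in_setC h inE.
  by rewrite cardsT card_ord -ltnNge; lia.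
case: (arg_minP (P := fun j => j \in px s) c j0p) => j1 j1p j1min.
have lowE : low (c j1) = ~: px s.
  apply/setP => j; rewrite in_setC inE; apply/idP/idP => [h|].
    by apply/negP => /j1min; rewrite leNgt h.
  by rewrite pxE -leNgt => h; apply: le_lt_trans h _; rewrite -pxE.
have : good j1.
  rewrite /good lowE hc andbT; apply/forall_inP => j; rewrite in_setC.
  exact: hp.
by move/kmax; rewrite /= leNgt -pxE j1p.
Qed.

Lemma Zfan_smooth s : s \in cones Z ->
  exists (B : 'M[int]_d) (f : ray Z -> 'I_d),
    [/\ B \in unitmx, {in s &, injective f} &
        {in s, forall r, row (f r) B = gen Z r}].
Proof.
move=> hs; have [k] := cone_omits hs; rewrite in_setU negb_or => /andP[kp kq].
have /coneP[/pred0P dpq _ _] := hs.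
have d0 : (0 < d)%N by lia.
pose idx (r : ray Z) : 'I_d.+1 := match r with inl j => j | inr i => val i end.
pose f r : 'I_d := odflt (Ordinal d0) (unlift k (idx r)).
have fE r : r \in s -> lift k (f r) = idx r.
  rewrite /f; case: unliftP => [l <-|] //= kr rs; exfalso.
  move: kp kq; rewrite -kr; case: r rs {kr} => [j|i] /= rs; first by rewrite inE rs.
  by move=> _ /imsetP; apply; exists i; rewrite ?inE.
pose sg j : int := (-1) ^+ (j \in qy s).
pose B : 'M[int]_d := \matrix_(l < d) (sg (lift k l) *: xvec (lift k l)).
pose cf l i : int := (i == lift k l)%:R - (i == k)%:R.
have cf0 l : \sum_i cf l i = 0.
  have one j : \sum_i (i == j :> 'I_d.+1)%:R = 1 :> int.
    by rewrite (bigD1 j) //= eqxx big1 ?addr0 // => i /negbTE ->.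
  by rewrite sumrB !one subrr.
pose C : 'M[int]_d :=
  \matrix_(p, l) (sg (lift k l) * cf l (widen_ord (leqnSn d) p)).
exists B, f; split.
- have BC : B *m C = 1%:M.
    apply/matrixP => l l'; rewrite mxE.
    transitivity (sg (lift k l) * sg (lift k l') * cf l' (lift k l)).
      rewrite -(pairing_xvec (lift k l) (cf0 l')) mulr_sumr.
      by apply: eq_bigr => p _; rewrite !mxE intz; ring.
    rewrite !mxE /cf (inj_eq lift_inj) -[lift k l == k]eq_sym.
    rewrite (negbTE (neq_lift _ _)) subr0.
    case: eqP => [->|]; last by rewrite mulr0.
    by rewrite mulr1 -expr2 sqrr_sign.
  by case: (mulmx1_unit BC).
- move=> r r' rs rs' /(congr1 (lift k)); rewrite !fE //.
  case: r r' rs rs' => [j|i] [j'|i'] rs rs' /=; first by move->.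
  + move=> E; have := dpq j; rewrite /= inE rs /= E => /negP[].
    by apply/imsetP; exists i'; rewrite ?inE.
  + move=> E; have := dpq j'; rewrite /= inE rs' /= -E => /negP[].
    by apply/imsetP; exists i; rewrite ?inE.
  + by move/val_inj ->.
- move=> r rs; rewrite rowK fE //; case: r rs => [j|i] rs /=.
    have := dpq j; rewrite /= inE rs /= /sg => ->; by rewrite scale1r.
  have -> : sg (val i) = -1; last by rewrite scaleN1r.
  suff h : val i \in qy s by rewrite /sg h.
  by apply/imsetP; exists i; rewrite ?inE.
Qed.

Lemma intersectionE (X : fan d) (s t : {set ray X}) (D : divisor X) (b : {ffun ray X -> int}) u :
  \sum_r b r *: gen X r = 0 -> (forall r, r \notin s :|: t -> b r = 0) ->
  (forall r, r \in s -> D r + pairing u (gen X r) = 0) ->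
  intersection D b = \sum_(r in t :\: s) (D r + pairing u (gen X r)) * b r.
Proof.
move=> b0 bs hu.
have ub : \sum_r pairing u (gen X r) * b r = 0.
  transitivity (\sum_k u 0 k * (\sum_r b r *: gen X r) 0 k).
    under eq_bigr do rewrite mulr_suml.
    rewrite exchange_big /=; apply: eq_bigr => k _.
    rewrite summxE mulr_sumr; apply: eq_bigr => r _.
    by rewrite !mxE intz; ring.
  by rewrite b0; apply: big1 => k _; rewrite mxE mulr0.
have -> : intersection D b =
    \sum_r D r * b r + \sum_r pairing u (gen X r) * b r by rewrite ub addr0.
rewrite -big_split /= [RHS]big_mkcond /=.
apply: eq_bigr => r _; rewrite -mulrDl inE.
have [rs|rs] /= := boolP (r \in s); first by rewrite hu ?mul0r.
by case: ifPn => // rt; rewrite bs ?mulr0 // inE negb_or rs.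
Qed.

Lemma Zfan_projective : exists D : divisor Z, ample D.
Proof.
pose D : divisor Z := [ffun r => if r is inl _ then 2 * m%:Z else 2 * m%:Z + 1].
exists D => b [s [t [/and3P[/andP[hs /eqP cs] /andP[ht /eqP ct] /eqP cst] b0 b1 brel]]].
have [k] := cone_omits hs; rewrite in_setU negb_or => /andP[kp kq].
have /coneP[dpq hq hp] := hs.
have iv (i : yidx) : (inr i \in s) = (val i \in qy s).
  by rewrite (qyE s (valP i)); congr (inr _ \in s); apply: val_inj.
have cpq : (#|px s| + #|qy s|)%N = d.
  rewrite -[RHS]cs -!sum1_card big_mkcond [X in (_ + X)%N]big_mkcond /=.
  rewrite [RHS]big_mkcond big_sumType /=; congr (_ + _)%N.
    by apply: eq_bigr => j _; rewrite inE.
  rewrite -[LHS]big_mkcond (partition_big (fun i : yidx => val i) predT) //=.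
  rewrite big_mkcond; apply: eq_bigr => j _.
  case: ifPn => [jq|jq].
    rewrite (big_pred1 (exist _ j (qy_lt jq) : yidx)) // iv /=.
    by rewrite jq.
  by rewrite big1 // => i /eqP ij; rewrite iv /= ij (negbTE jq).
have kE j : j != k -> j \notin px s -> j \in qy s.
  move=> jk jp; apply/negPn/negP => jq.
  have : (#|px s :|: qy s| <= #|~: [set j; k]|)%N.
    apply: subset_leq_card; apply/subsetP => i; rewrite in_setU in_setC in_set2.
    by apply: contraL => /orP[] /eqP ->; rewrite negb_or ?jp ?kp.
  have := cardsC [set j; k]; rewrite cards2 jk card_ord.
  have -> : #|px s :|: qy s| = d.
    apply: etrans cpq; rewrite cardsU; by move: dpq; rewrite -setI_eq0 => /eqP ->; rewrite cards0 subn0.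
  by move=> /= cE le_pq; clear -cE le_pq; lia.
have natmulE (x : int) p : x *+ p = x * p%:Z by rewrite -mulr_natr natz.
pose A : int := 2 * m%:Z; pose B : int := 2 * m%:Z + 1.
pose ck : int := A * #|px s|%:Z - B * #|qy s|%:Z.
pose c j : int := if j == k then ck else if j \in px s then - A else B.
have c0 : \sum_j c j = 0.
  rewrite (bigD1 k) //= {1}/c eqxx.
  have -> : \sum_(j | j != k) c j = \sum_(j in px s) (- A) + \sum_(j in qy s) B.
    rewrite big_mkcond [X in _ = X + _]big_mkcond [X in _ = _ + X]big_mkcond.
    rewrite -big_split; apply: eq_bigr => j _ /=; rewrite /c.
    have [->|jk] /= := eqVneq j k; first by rewrite (negbTE kp) (negbTE kq) addr0.
    case: ifPn => jp; last by rewrite (kE j) ?add0r.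
    by have /pred0P/(_ j) := dpq; rewrite /= jp /= => ->; rewrite addr0.
  by rewrite !sumr_const /ck -!natmulE mulNrn addrACA subrr add0r addNr.
pose u := \row_l c (widen_ord (leqnSn d) l).
have ux j : pairing u (xvec j) = c j by apply: pairing_xvec.
have uN v : pairing u (- v) = - pairing u v.
  by rewrite /pairing -sumrN; apply: eq_bigr => l _; rewrite [(- v) 0 l]mxE !intz mulrN.
have AB0 : 0 < A + B by rewrite /A /B; clear -hm; lia.
have [ckx cky] : 0 < A + ck /\ (#|qy s| = m -> 0 < B - ck).
  rewrite /ck /A /B; move: #|px s| #|qy s| cpq hq => p q pq qm.
  have e1 := leq_b1 e; clear -pq qm hm e1; move: (nat_of_bool e) pq e1 => e' pq e1.
  split=> [|qE].
    by apply: (@ample_x _ _ _ e'%:Z); lia.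
  by apply: (@ample_y _ _ _ e'%:Z); lia.
have hD r : (r \in s -> D r + pairing u (gen Z r) = 0) /\
            (r \notin s -> 0 < D r + pairing u (gen Z r)).
  case: r => [j|i]; rewrite /D ffunE /= ?uN ux /c.
    have -> : (inl j \in s) = (j \in px s) by rewrite inE.
    have [->|jk] := eqVneq j k; first by rewrite (negbTE kp); split.
    by case: ifP => jp; split=> // _; rewrite subrr.
  rewrite iv -![sval i]/(val i); have := valP i; move: (val i) => j hj.
  have [jk|jk] := eqVneq j k.
    rewrite jk (negbTE kq); split=> // _; apply: cky.
    have : (m < #|~: px s|)%N.
      apply: hp => j' jp'; have [->|jk'] := eqVneq j' k.
        by move: hj; rewrite jk.
      exact: qy_lt (kE j' jk' jp').
    have := cardsC (px s); rewrite card_ord; move: #|px s| #|~: px s| #|qy s| cpq hq.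
    by clear => p p' q; lia.
  case: ifP => jp; split.
  - by have /pred0P/(_ j) := dpq; rewrite /= jp /= => ->.
  - by move=> _; rewrite opprK addrC.
  - by move=> _; apply: subrr.
  - by rewrite (kE j) ?jp.
rewrite (intersectionE (s := s) (t := t) (u := u) brel b0); last first.
  by move=> r; case: (hD r).
have bt r : r \in t :\: s -> b r = 1.
  by rewrite inE => /andP[rs rt]; apply: b1; rewrite !inE (negbTE rs) rt.
have [r0 r0ts] : exists r, r \in t :\: s.
  apply/set0Pn; rewrite -card_gt0 cardsD setIC ct; lia.
rewrite (bigD1 r0) //= bt // mulr1; apply: ltr_wpDr.
  apply: sumr_ge0 => r /andP[rts _]; rewrite bt // mulr1 ltW //.
  by have [_] := hD r; apply; move: rts; rewrite inE => /andP[].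
by have [_] := hD r0; apply; move: r0ts; rewrite inE => /andP[].
Qed.

Lemma Zfan_smooth_projective : smooth_projective Z.
Proof.
split; [exact: Zfan_ray | exact: Zfan_face | exact: Zfan_smooth
  | exact: Zfan_meet | exact: Zfan_complete | exact: Zfan_projective].
Qed.

Lemma card_val (A : {set yidx}) : #|[set val i | i in A]| = #|A|.
Proof. by apply: card_imset; apply: val_inj. Qed.

Lemma card_xset (A : {set 'I_d.+1}) : #|xset n A| = #|A|.
Proof. by apply: card_imset => j k []. Qed.

Lemma card_yset (A : {set yidx}) : #|yset A| = #|A|.
Proof. by apply: card_imset => i k []. Qed.

Lemma card_compl (A : {set yidx}) : (#|A| + #|compl A|)%N = d.+1.
Proof. by rewrite -(card_val A) cardsC card_ord. Qed.

Lemma Zprim_antichain (P P' : {set ray Z}) :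
  P \in Zprim e m n -> P' \in Zprim e m n -> P' \subset P -> (#|P| <= #|P'|)%N.
Proof.
have ltm := hm; rewrite /Zprim !in_setU -!orbA => hP hP' /subsetP PP'.
case/or3P: hP PP' => /imsetP.
- case=> i _ -> _; rewrite cards2 /=.
  case/or3P: hP' => /imsetP.
  + by case=> i' _ ->; rewrite cards2.
  + case=> I; rewrite inE => /eqP cI ->; rewrite card_xset.
    by have := card_compl I; lia.
  + by case=> J; rewrite inE => /eqP cJ ->; rewrite card_yset cJ.
- case=> I; rewrite inE => /eqP cI ->; case/or3P: hP' => /imsetP.
  + case=> i _ -> /(_ (inr i)); rewrite !inE eqxx orbT => /(_ isT).
    by case/imsetP.
  + case=> I'; rewrite inE => /eqP cI' ->; rewrite !card_xset => _.
    have := card_compl I; have := card_compl I'; lia.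
  + case=> J; rewrite inE => /eqP cJ -> h.
    have : (0 < #|J|)%N by rewrite cJ.
    by case/card_gt0P=> i iJ; have := h (inr i); case/(_ (imset_f _ iJ))/imsetP.
- case=> J; rewrite inE => /eqP cJ ->; case/or3P: hP' => /imsetP.
  + case=> i _ -> /(_ (inl (val i))); rewrite !inE eqxx => /(_ isT).
    by case/imsetP.
  + case=> I; rewrite inE => /eqP cI -> h.
    have : (0 < #|compl I|)%N by have := card_compl I; lia.
    by case/card_gt0P=> j jI; have := h (inl j); case/(_ (imset_f _ jI))/imsetP.
  + by case=> J'; rewrite inE => /eqP cJ' ->; rewrite !card_yset cJ cJ'.
Qed.

Lemma Zfan_primitive_collections P :
  primitive_collection (X := Z) P = (P \in Zprim e m n).
Proof.
have out P' : P' \in Zprim e m n -> P' \notin cones Z.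
  by move=> hP'; rewrite inE negbK; apply/exists_inP; exists P'.
apply/andP/idP => [[] | hP].
  rewrite inE negbK => /exists_inP[P' hP' P'P] /forallP h.
  have := h P'; rewrite (negbTE (out _ hP')) implybF properEneq P'P andbT negbK.
  by move/eqP <-.
split; first exact: out.
apply/forallP => s; apply/implyP => sP; rewrite inE.
apply/exists_inPn => P' hP'; apply/negP => P's.
have P'P := sub_proper_trans P's sP.
have := proper_card P'P; rewrite ltnNge Zprim_antichain //.
exact: proper_sub.
Qed.

Lemma sum_compl (A : {set yidx}) :
  \sum_(j in compl A) xvec j = \sum_(i in A) gen Z (inr i).
Proof.
have x0 : \sum_(j : 'I_d.+1) xvec j = 0 :> 'rV[int]_d.
  apply/rowP => k; rewrite summxE; under eq_bigr do rewrite mxE.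
  have one (p : 'I_d.+1) : \sum_(j < d.+1) (j == p :> nat)%:R = 1 :> int.
    by rewrite (bigD1 p) //= eqxx big1 ?addr0 // => j /negbTE; rewrite -val_eqE /= => ->.
  by rewrite sumrB (one ord_max) (one (widen_ord (leqnSn d) k)) subrr mxE.
have imE : \sum_(i in A) xvec (val i) = \sum_(j in [set val i | i in A]) xvec j.
  by rewrite big_imset // => i k _ _ /val_inj.
transitivity (- \sum_(i in A) xvec (val i)); last by rewrite -sumrN.
apply/eqP; rewrite imE -addr_eq0 -[X in _ == X]x0.
rewrite [X in _ == X](bigID (mem [set val i | i in A])) /= addrC.
by under eq_bigl do rewrite inE.
Qed.

Lemma Zfan_primitive_relations :
  [/\ forall i : yidx, gen Z (inl (val i)) + gen Z (inr i) = 0,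
      forall I : {set yidx}, #|I| = m ->
        \sum_(r in xset n (compl I)) gen Z r = \sum_(r in yset I) gen Z r /\
        yset I \in cones Z &
      forall J : {set yidx}, #|J| = m.+1 ->
        \sum_(r in yset J) gen Z r = \sum_(r in xset n (compl J)) gen Z r /\
        xset n (compl J) \in cones Z].
Proof.
have sumE (A : {set yidx}) :
    \sum_(r in xset n (compl A)) gen Z r = \sum_(r in yset A) gen Z r.
  rewrite !big_imset /=; [exact: sum_compl | by move=> i k _ _ [] ..].
have px_y (A : {set yidx}) : px (yset A) = set0.
  by apply/setP => j; rewrite !inE; apply/imsetP => -[].
have qy_y (A : {set yidx}) : qy (yset A) = [set val i | i in A].
  congr [set val i | i in pred_of_set _]; apply/setP => i; rewrite inE.
  by apply/imsetP/idP => [[i' h [->]] //|h]; exists i.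
have qy_x A : qy (xset n A) = set0.
  by apply/setP => j; rewrite in_set0; apply/negbTE/imsetP => -[i]; rewrite inE; case/imsetP.
have px_x A : px (xset n A) = A.
  apply/setP => j; rewrite inE.
  by apply/imsetP/idP => [[i' h [->]] //|h]; exists j.
split=> [i|I cI|J cJ]; first by rewrite /= subrr.
- split; first exact: sumE.
  apply/coneP; rewrite px_y qy_y card_val cI disjoints_subset sub0set; split => //.
  by rewrite setC0 cardsT card_ord; lia.
- split; first by rewrite sumE.
  apply/coneP; rewrite px_x qy_x cards0; split => //.
    by rewrite disjoint_sym disjoints_subset sub0set.
  by rewrite setCK card_val cJ.
Qed.

End Facts.

(* Main.v *)
Require Import Defs.
From mathcomp Require Import all_boot all_order all_algebra.
From mathcomp Require Import reals constructive_ereal ereal.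
From mathcomp Require Import zify ring.

Set Implicit Arguments.
Unset Strict Implicit.
Unset Printing Implicit Defensive.

Import Order.TTheory GRing.Theory Num.Theory.
Local Open Scope ring_scope.

(** Write a divisor as [\sum_j a_j x_j + \sum_i b_i y_i].  Characters shift
    [a_j] by [u_j] and [b_i] by [- u_i], with [\sum_j u_j = 0], so the class is
    determined by the numbers [c_i = a_i + b_i] for [i < n] and
    [A = \sum_j a_j] ([lin_equivP]).  The relations
    [\sum_(j notin I) x_j = \sum_(i in I) y_i] for [#|I| = m], and those with
    the two sides exchanged for [#|I| = m.+1], are relations of walls, and they
    generate the cone of curves.  Hence ([nefP]) the class is nef exactly when
    every sum of [m] of the [c_i] is at most [A] and every sum of [m.+1] of them
    is at least [A]; in particular the [c_i] are nonnegative.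

    Integrality enters through one observation
    ([nef_at_most_one_zero_fiber]): when [m + 2 <= n], a nonzero nef class has
    at most one vanishing [c_i].  For if [c_p = c_q = 0], replacing [p] and [q]
    by a single [r] in a set of [m.+1] indices shows [c_r <= 0], so all [c_i],
    and then [A], vanish.  As the other [c_i] are integers, hence at least 1, a
    nonzero nef class satisfies [m <= A] and, since the sum of a suitable set of
    [m.+1] of the [c_i] is at least [A], also
    [n - m.+1 <= \sum_i c_i - A].

    Each of these two lower bounds is a linear form that is bounded below on the
    summands of a decomposition, so evaluating it on the anticanonical class,
    for which [c_i = 2] and [A = 2 * m + e + 1], bounds the total coefficient
    ([nef_decomposition_le_form]).  For [e = 0] the first form gives
    [(2 * m + 1) / m], which is less than 3 because [2 <= m]; for [e = 1] the
    second one gives [2 * (n - m.+1) / (n - m.+1) = 2].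

    The bounds are attained.  The classes with all [c_i = 1] and [A = m + e] or
    [A = m.+1] are nef and add up to the anticanonical class, which gives 2.
    When [e = 0], for each of the [2 * m + 1] indices [k] the class with [A = m],
    [c_k = 0] (if [k < n]) and all other [c_i = 1] is nef, and the sum of all
    these classes is [m] times the anticanonical class. *)

(** * Divisor classes *)

Lemma subset_card_between (T : finType) (A C : {set T}) c :
  A \subset C -> (#|A| <= c <= #|C|)%N ->
  exists B : {set T}, [/\ A \subset B, B \subset C & #|B| = c].
Proof.
move=> AC /andP[Ac cC].
have /sub_pick[B BCA cB] : (c - #|A| <= #|C :\: A|)%N.
  by rewrite cardsD (setIidPr AC) leq_sub2r.
have /subsetDP[BC dBA] := BCA.
exists (A :|: B); split; rewrite ?subsetUl ?subUset ?AC //.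
have /eqP dAB : A :&: B == set0 by rewrite setI_eq0 disjoint_sym.
by rewrite cardsU dAB cards0 subn0 cB subnKC.
Qed.

Section Classes.
Variables (e : bool) (m n : nat).
Hypotheses (hm : (1 <= m)%N) (hn : (m + 2 <= n <= 2 * m + e + 1)%N).
Local Notation d := (2 * m + e)%N.
Local Notation Z := (Zfan e m n).
Local Notation yidx := (yidx e m n).

Let hn1 : (m + 1 <= n <= d + 1)%N.
Proof. lia. Qed.

Lemma card_yidx : #|{: yidx}| = n.
Proof.
rewrite -[RHS](card_ylt hm hn1) -cardsT -(card_val [set: yidx]).
congr #|pred_of_set _|; apply/setP => j; rewrite inE.
apply/imsetP/idP => [[i _ ->]|hj]; first exact: (valP i).
by exists (exist _ j hj).
Qed.

Section Invariants.
Variable K : pzRingType.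
Implicit Types D E : {ffun ray Z -> K}.

(** The degree of [D] on the relation [x_i + y_i = 0]. *)
Definition fiber_degree D (i : yidx) : K := D (inl (val i)) + D (inr i).
Definition x_degree D : K := \sum_(j : 'I_d.+1) D (inl j).

Lemma pairingN (u : 'rV[K]_d) v : pairing u (- v) = - pairing u v.
Proof. by rewrite /pairing -sumrN; apply: eq_bigr => k _; rewrite mxE mulrNz mulrN. Qed.

Lemma sum_pairing_xvec (u : 'rV[K]_d) : \sum_(j : 'I_d.+1) pairing u (xvec j) = 0.
Proof.
rewrite exchange_big /=; apply: big1 => k _.
rewrite -mulr_sumr -rmorph_sum /=.
have := sum_compl (set0 : {set yidx}); rewrite big_set0 => /rowP/(_ k).
rewrite /compl imset0 setC0 summxE mxE big_set /= => ->.
by rewrite mulr0.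
Qed.

(** The translations by characters of the coefficients on the [x_j] are exactly
    the vectors with sum zero, and they determine the translation of the
    coefficients on the [y_i]. *)
Lemma lin_equivP D E :
  lin_equiv D E <->
  (forall i, fiber_degree D i = fiber_degree E i) /\ x_degree D = x_degree E.
Proof.
split=> [[u hu]|[hc hA]].
  split=> [i|]; apply/eqP; rewrite -subr_eq0.
    rewrite /fiber_degree opprD addrACA !hu /= pairingN.
    by rewrite -[sval i]/(val i) subrr.
  rewrite /x_degree -sumrB; under eq_bigr do rewrite hu.
  by rewrite /= sum_pairing_xvec.
pose c j := D (inl j) - E (inl j).
have c0 : \sum_j c j = 0 by rewrite sumrB; apply/eqP; rewrite subr_eq0; apply/eqP.
exists (\row_k c (widen_ord (leqnSn d) k)) => -[j|i] /=.
  by rewrite (pairing_xvec hm hn1).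
rewrite pairingN (pairing_xvec hm hn1) // /c opprB -[sval i]/(val i).
have /eqP := hc i; rewrite -subr_eq0 /fiber_degree opprD addrACA addrC.
by rewrite addr_eq0 opprB => /eqP.
Qed.

End Invariants.

Implicit Types (D E : divisor Z) (A I J : {set yidx}).

(** * The nef cone *)

Definition circuit A : {set ray Z} := xset n (compl A) :|: yset A.

(** The relation [\sum_(j notin A) x_j - \sum_(i in A) y_i = 0]. *)
Definition circuit_coef A : {ffun ray Z -> int} :=
  [ffun r => match r with
             | inl j => (j \in compl A)%:R
             | inr i => - (i \in A)%:R
             end].

Lemma mem_circuit A r :
  (r \in circuit A) = match r with inl j => j \in compl A | inr i => i \in A end.
Proof.
rewrite in_setU; case: r => [j|i].
  rewrite (mem_imset _ _ (@inl_inj _ _)) orbC; case: imsetP => //.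
  by case.
by rewrite (mem_imset _ _ (@inr_inj _ _)); case: imsetP => // -[].
Qed.

Lemma card_circuit A : #|circuit A| = d.+1.
Proof.
rewrite cardsU card_xset card_yset.
have -> : xset n (compl A) :&: yset A = set0.
  by apply/setP=> r; rewrite !inE; apply/negP => /andP[/imsetP[j _ ->] /imsetP[]].
by rewrite cards0 subn0 addnC card_compl.
Qed.

Lemma circuit_relation A :
  \sum_r circuit_coef A r *: gen Z r = 0.
Proof.
rewrite big_sumType /=.
have -> : \sum_(j : 'I_d.+1) circuit_coef A (inl j) *: xvec j
        = \sum_(j in compl A) xvec j.
  rewrite [RHS]big_mkcond; apply: eq_bigr => j _; rewrite ffunE.
  by case: ifP; rewrite ?scale1r ?scale0r.
rewrite sum_compl [X in X + _]big_mkcond -big_split big1 //= => i _.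
rewrite ffunE; case: ifP; rewrite ?scaleN1r ?subrr //.
by rewrite oppr0 scale0r addr0.
Qed.

Lemma intersection_circuit D A :
  intersection D (circuit_coef A) =
  x_degree D - \sum_(i in A) fiber_degree D i.
Proof.
rewrite /intersection big_sumType /= /x_degree.
rewrite [\sum_(j : 'I_d.+1) D (inl j)](bigID (mem (compl A))) /=.
rewrite /fiber_degree big_split /=.
have -> : \sum_(j | j \notin compl A) D (inl j) = \sum_(i in A) D (inl (val i)).
  rewrite -(big_imset (fun j => D (inl j)) (h := fun i : yidx => val i)) /=.
    by apply: eq_bigl => j; rewrite inE negbK.
  by move=> i i' _ _ /val_inj.
rewrite opprD addrA addrK; congr (_ + _).
  rewrite [RHS]big_mkcond; apply: eq_bigr => j _; rewrite ffunE.
  by case: ifP; rewrite ?mulr1 ?mulr0.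
rewrite -sumrN [RHS]big_mkcond; apply: eq_bigr => i _; rewrite ffunE.
by case: ifP; rewrite ?mulrN1 ?oppr0 ?mulr0.
Qed.

(** Removing either of two rays from a circuit leaves two cones that meet in a
    wall, whose relation is the one of the circuit up to the sign [z] that makes
    it 1 on these two rays. *)
Lemma circuit_curve A (z : int) r1 r2 :
  r1 != r2 -> r1 \in circuit A -> r2 \in circuit A ->
  z * circuit_coef A r1 = 1 -> z * circuit_coef A r2 = 1 ->
  circuit A :\ r1 \in cones Z -> circuit A :\ r2 \in cones Z ->
  invariant_curve [ffun r => z * circuit_coef A r].
Proof.
move=> r12 r1U r2U b1 b2 c1 c2.
exists (circuit A :\ r2), (circuit A :\ r1).
have cU r : r \in circuit A -> #|circuit A :\ r| = d.
  by move=> rU; have := cardsD1 r (circuit A); rewrite rU card_circuit => -[].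
have capE : (circuit A :\ r2) :&: (circuit A :\ r1) = circuit A :\ r1 :\ r2.
  apply/setP=> r; rewrite in_setI !in_setD1.
  by case: (r \in circuit A); rewrite ?andbF ?andbT.
split.
- rewrite /wall /maxcone c1 c2 !cU // !eqxx capE /=.
  have := cardsD1 r2 (circuit A :\ r1); rewrite cU // in_setD1 [r2 == r1]eq_sym r12 r2U.
  by rewrite add1n => <-.
- move=> r; rewrite ffunE in_setU !in_setD1 => h.
  have : r \notin circuit A.
    apply: contra h => ->; rewrite !andbT.
    by have [->|//] := eqVneq r r2; rewrite eq_sym r12.
  rewrite mem_circuit ffunE; case: r {h} => [j|i] /negbTE ->.
    by rewrite mulr0.
  by rewrite oppr0 mulr0.
- move=> r; rewrite capE in_setD in_setU !in_setD1 ffunE.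
  have [->//|_] := eqVneq r r1; have [->//|_] := eqVneq r r2.
  by rewrite /= orbb andNb.
- under eq_bigr do rewrite ffunE -scalerA.
  by rewrite -scaler_sumr circuit_relation scaler0.
Qed.


(** When [#|A| = m] the relation of the circuit has the [x_j] as its primitive
    side, when [#|A| = m.+1] the [y_i]; dropping a ray of the primitive side
    breaks the only primitive collection in the circuit. *)
Lemma circuit_cone A r : r \in circuit A ->
  #|A| = (m + (if r is inr _ then 1 else 0))%N -> circuit A :\ r \in cones Z.
Proof.
move=> rU cA; apply/(coneP hm hn1) => /=.
set px := [set j | _]; set qy := imset _ _.
have pxE : px \subset compl A.
  by apply/subsetP => j; rewrite in_set in_setD1 mem_circuit => /andP[].
have qyE : qy \subset [set val i | i in A].
  apply/imsetS/subsetP => i; rewrite in_set in_setD1 mem_circuit => /andP[_ iA].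
  exact: iA.
have cc := card_compl A.
split.
- rewrite disjoints_subset; apply: subset_trans pxE _.
  by rewrite /compl setCS.
- case: r rU cA @px @qy pxE qyE => [k|k] rU cA px qy pxE qyE.
    by rewrite (leq_trans (subset_leq_card qyE)) // card_val cA addn0.
  have kA : k \in A by move: rU; rewrite mem_circuit.
  rewrite card_val (leq_trans (n := #|A :\ k|)) //.
    apply: subset_leq_card; apply/subsetP => i; rewrite in_set !in_setD1 mem_circuit.
    by case/andP => ik ->; rewrite andbT; apply: contra ik => /eqP ->.
  by have := cardsD1 k A; rewrite kA cA /= addn1 add1n => -[<-].
- move=> _; have := cardsC px; rewrite card_ord.
  case: r rU cA @px @qy pxE qyE => [k|k] rU cA px qy pxE qyE.
    have kA : k \in compl A by move: rU; rewrite mem_circuit.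
    have : (#|px| <= #|compl A :\ k|)%N.
      apply: subset_leq_card; apply/subsetP => j; rewrite in_set !in_setD1 mem_circuit.
      by case/andP => jk ->; rewrite andbT; apply: contra jk => /eqP ->.
    have := cardsD1 k (compl A); rewrite kA; move: cA cc => /=.
    by move: #|A| #|compl A| #|compl A :\ k| #|px| #|~: px|; lia.
  have := subset_leq_card pxE; move: cA cc => /=.
  by move: #|A| #|compl A| #|px| #|~: px|; lia.
Qed.

Lemma nef_sum_fiber_degree_le D I :
  nef D -> #|I| = m -> \sum_(i in I) fiber_degree D i <= x_degree D.
Proof.
move=> hD cI; rewrite -subr_ge0 -intersection_circuit.
have cc := card_compl I.
have /card_gt1P[k1 [k2 [k1I k2I k12]]] : (1 < #|compl I|)%N by lia.
have -> : circuit_coef I = [ffun r => 1 * circuit_coef I r].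
  by apply/ffunP => r; rewrite [RHS]ffunE mul1r.
apply: hD; apply: (@circuit_curve _ _ (inl k1) (inl k2)).
- by apply: contra k12 => /eqP [->].
- by rewrite mem_circuit.
- by rewrite mem_circuit.
- by rewrite ffunE k1I mulr1.
- by rewrite ffunE k2I mulr1.
- by apply: circuit_cone; rewrite ?mem_circuit ?cI ?addn0.
- by apply: circuit_cone; rewrite ?mem_circuit ?cI ?addn0.
Qed.

Lemma nef_le_sum_fiber_degree D J :
  nef D -> #|J| = m.+1 -> x_degree D <= \sum_(i in J) fiber_degree D i.
Proof.
move=> hD cJ; rewrite -subr_le0 -intersection_circuit -oppr_ge0.
have /card_gt1P[k1 [k2 [k1J k2J k12]]] : (1 < #|J|)%N by lia.
have -> : - intersection D (circuit_coef J) =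
          intersection D [ffun r => -1 * circuit_coef J r].
  by rewrite /intersection -sumrN; apply: eq_bigr => r _; rewrite !ffunE; ring.
apply: hD; apply: (@circuit_curve _ _ (inr k1) (inr k2)).
- by apply: contra k12 => /eqP [->].
- by rewrite mem_circuit.
- by rewrite mem_circuit.
- by rewrite ffunE k1J mulN1r opprK.
- by rewrite ffunE k2J mulN1r opprK.
- by apply: circuit_cone; rewrite ?mem_circuit ?cJ ?addn1.
- by apply: circuit_cone; rewrite ?mem_circuit ?cJ ?addn1.
Qed.

(** Each [c i] is the difference of a sum of [m.+1] terms and the sum of [m] of
    them, and [a] separates these two sums. *)
Lemma sums_separated_ge0 (c : yidx -> int) (a : int) :
  (forall I, #|I| = m -> \sum_(i in I) c i <= a) ->
  (forall J, #|J| = m.+1 -> a <= \sum_(i in J) c i) ->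
  forall i, 0 <= c i.
Proof.
move=> hI hJ i; have [] := @subset_card_between _ [set i] setT m.+1 (subsetT _).
  by rewrite cards1 cardsT card_yidx; lia.
move=> J [iJ _ cJ]; rewrite sub1set in iJ.
have cJi : #|J :\ i| = m by have := cardsD1 i J; rewrite iJ cJ => -[].
have := le_trans (hI _ cJi) (hJ _ cJ).
by rewrite (big_setD1 i iJ) /= lerDr.
Qed.

(** Given a maximal cone [s], translate [D] by the character that makes it vanish
    on [s]; the inequalities say that all its other coefficients are then
    nonnegative, so it has nonnegative degree on every curve through a wall of
    [s]. *)
Lemma nef_of_degrees D :
  (forall I, #|I| = m -> \sum_(i in I) fiber_degree D i <= x_degree D) ->
  (forall J, #|J| = m.+1 -> x_degree D <= \sum_(i in J) fiber_degree D i) ->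
  nef D.
Proof.
move=> hI hJ; have c0 := sums_separated_ge0 hI hJ.
move=> b [s [t [/and3P[/andP[hs /eqP cs] /andP[ht _] _] b0 b1 brel]]].
have [k] := cone_omits hm hn1 hs; rewrite in_setU negb_or => /andP[kp kq].
have /(coneP hm hn1)[dpq hq hp] := hs.
move: kp kq dpq hq hp => /=; set px := [set j | _]; set qy := imset _ _.
rewrite card_val; set I := [set i | _] => kp kq dpq hq hp.
have memq i : (val i \in qy) = (i \in I) by rewrite (mem_imset _ _ val_inj).
(* [w j] is the coefficient on [x_j] of the translate of [D], and [k] is the
   index that [s] omits. *)
pose w j := if j == k then x_degree D - \sum_(i in I) fiber_degree D i
            else \sum_(i in I | val i == j) fiber_degree D i.
have w_x j : j \in px -> w j = 0.
  move=> jp; rewrite /w ifN; last by apply: contraNneq kp => <-.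
  apply: big1 => i /andP[iI /eqP ij].
  by have /pred0P/(_ j) := dpq; rewrite /= jp -ij memq iI.
have w_y i : i \in I -> w (val i) = fiber_degree D i.
  move=> iI; rewrite /w ifN; last by apply: contraNneq kq => <-; rewrite memq.
  by rewrite (big_pred1 i) // => i'; rewrite /= (inj_eq val_inj) andb_idl // => /eqP ->.
have sum_w : \sum_j w j = x_degree D.
  rewrite (bigD1 k) //= {1}/w eqxx.
  rewrite [X in _ - X](partition_big (fun i : yidx => val i) (fun j => j != k)) /=.
    by under [X in _ + X]eq_bigr => j /negbTE jk do rewrite /w jk; rewrite subrK.
  by move=> i iI; apply: contraNneq kq => <-; rewrite memq.
have cI : \sum_(i in I) fiber_degree D i <= x_degree D.
  have [] := @subset_card_between _ I setT m (subsetT _).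
    by rewrite hq cardsT card_yidx; lia.
  move=> I' [II' _ /hI]; apply: le_trans.
  rewrite [leRHS](big_setID I) /= (setIidPr II') lerDl.
  exact: sumr_ge0.
(* If the omitted index carries a ray [y_k], the maximal cone [s] contains
   exactly [m] of the rays [y_i]. *)
have full (i : yidx) : val i = k -> #|I| = m.
  move=> ik; apply/eqP; rewrite eqn_leq hq /= -ltnS.
  have -> : #|I|.+1 = #|k |: qy| by rewrite cardsU1 kq card_val.
  have pq_full : k |: qy = ~: px.
    have : (#|px| + #|I|)%N = d.
      rewrite -[RHS]cs -(card_xset n) -(card_yset I).
      have <- : xset n px :|: yset I = s.
        apply/setP => -[j|i']; rewrite in_setU.
          rewrite (mem_imset _ _ (@inl_inj _ _)) inE orb_idr //.
          by case/imsetP.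
        by rewrite [_ \in yset I](mem_imset _ _ (@inr_inj _ _)) inE orb_idl //; case/imsetP.
      rewrite cardsU; have -> : xset n px :&: yset I = set0.
        by apply/setP=> r; rewrite !inE; apply/negP => /andP[/imsetP[j _ ->] /imsetP[]].
      by rewrite cards0 subn0.
    move=> cpq; apply/eqP; rewrite eqEcard subUset sub1set in_setC kp /=.
    rewrite -disjoints_subset disjoint_sym dpq cardsU1 kq card_val.
    have := cardsC px; rewrite card_ord; move: cpq.
    by move: #|px| #|I| #|~: px| => /=; lia.
  rewrite pq_full; apply: hp => j; rewrite -in_setC -pq_full in_setU1.
  case/orP => [/eqP ->|/imsetP[i' _ ->]]; last exact: (valP i').
  by have := valP i; rewrite ik.
pose c j := w j - D (inl j).
have c_sum : \sum_j c j = 0 by rewrite sumrB sum_w subrr.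
pose u := \row_l c (widen_ord (leqnSn d) l).
have ux j : pairing u (xvec j) = c j by apply: (pairing_xvec hm hn1).
have vx j : D (inl j) + pairing u (gen Z (inl j)) = w j.
  by rewrite /= ux addrC subrK.
have vy i : D (inr i) + pairing u (gen Z (inr i)) = fiber_degree D i - w (val i).
  by rewrite /= pairingN ux -[sval i]/(val i) /c /fiber_degree; ring.
rewrite (intersectionE (s := s) (t := t) (u := u) brel b0); last first.
  move=> [j|i] rs; first by rewrite vx w_x // inE.
  by rewrite vy w_y ?subrr // inE.
apply: sumr_ge0 => r; rewrite inE => /andP[rs rt].
rewrite b1 ?mulr1; last by rewrite !inE (negbTE rs) rt.
case: r rs {rt} => [j|i] rs.
  by rewrite vx /w; case: ifP => _; rewrite ?subr_ge0 // sumr_ge0.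
rewrite vy /w; case: eqP => [ik|_].
  have iI : i \notin I by rewrite inE.
  have /hJ : #|i |: I| = m.+1 by rewrite cardsU1 iI (full i ik).
  by rewrite big_setU1 //= opprB addrA subr_ge0.
rewrite big1 ?subr0 // => i' /andP[i'I /eqP/val_inj ii'].
by move: rs i'I; rewrite inE ii' => /negbTE ->.
Qed.

Lemma nefP D :
  nef D <->
  (forall I, #|I| = m -> \sum_(i in I) fiber_degree D i <= x_degree D) /\
  (forall J, #|J| = m.+1 -> x_degree D <= \sum_(i in J) fiber_degree D i).
Proof.
split=> [hD|[hI hJ]]; last exact: nef_of_degrees.
by split=> [I|J]; [apply: nef_sum_fiber_degree_le | apply: nef_le_sum_fiber_degree].
Qed.

(** * Nonzero nef classes *)

Definition divisor_of_degrees (c : yidx -> int) (a : int) : divisor Z :=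
  [ffun r => match r with
             | inl j => if j == ord0 then a else 0
             | inr i => c i - if val i == ord0 then a else 0
             end].

Lemma fiber_degree_of_degrees c a i :
  fiber_degree (divisor_of_degrees c a) i = c i.
Proof. by rewrite /fiber_degree !ffunE addrC subrK. Qed.

Lemma x_degree_of_degrees c a : x_degree (divisor_of_degrees c a) = a.
Proof.
rewrite /x_degree (bigD1 ord0) //= ffunE eqxx big1 ?addr0 // => j /negbTE j0.
by rewrite ffunE j0.
Qed.

(** Let [p] and [q] index vanishing fiber degrees.  For any other [r], a set [J]
    of [m.+1] indices that contains [p] and [q] but not [r] exists because
    [m + 2 <= n].  Comparing [J] with the set of [m] indices where [r] replaces
    both [p] and [q] shows that the fiber degree of [r] is at most 0. *)
Lemma nef_at_most_one_zero_fiber D :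
  nef D -> ~ lin_equiv D 0 -> (#|[set i | fiber_degree D i == 0]| <= 1)%N.
Proof.
move=> /nefP[hI hJ] D0; have c_ge0 := sums_separated_ge0 hI hJ.
rewrite leqNgt; apply/negP => /card_gt1P[p [q []]].
rewrite !inE => /eqP p0 /eqP q0 pq; apply: D0.
have c0 r : fiber_degree D r = 0.
  have [->//|rp] := eqVneq r p; have [->//|rq] := eqVneq r q.
  have [] := @subset_card_between _ [set p; q] [set~ r] m.+1.
    by rewrite subUset !sub1set !inE ![_ == r]eq_sym rp rq.
  - by rewrite cards2 pq cardsC1 card_yidx; lia.
  move=> J [pqJ Jr cJ].
  have pJ : p \in J by apply: (subsetP pqJ); rewrite !inE eqxx.
  have qJ : q \in J :\ p.
    by rewrite in_setD1 eq_sym pq /=; apply: (subsetP pqJ); rewrite !inE eqxx orbT.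
  have rJ : r \notin J by apply/negP => /(subsetP Jr); rewrite !inE eqxx.
  have cI : #|r |: (J :\ p :\ q)| = m.
    have := cardsD1 p J; rewrite (cardsD1 q (J :\ p)) pJ qJ cJ => -[mE].
    by rewrite cardsU1 !in_setD1 (negbTE rJ) !andbF [RHS]mE.
  have := le_trans (hI _ cI) (hJ _ cJ).
  rewrite big_setU1 ?in_setD1 ?(negbTE rJ) ?andbF //=.
  rewrite [leRHS](big_setD1 p pJ) /= (big_setD1 q qJ) /= p0 q0 !add0r gerDr => cr.
  by apply/le_anti; rewrite cr c_ge0.
have [I _ cI] : exists2 I : {set yidx}, I \subset setT & #|I| = m.
  by apply: sub_pick; rewrite cardsT card_yidx; lia.
have [J _ cJ] : exists2 J : {set yidx}, J \subset setT & #|J| = m.+1.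
  by apply: sub_pick; rewrite cardsT card_yidx; lia.
apply/lin_equivP; split=> [i|].
  by rewrite c0 /fiber_degree !ffunE addr0.
rewrite {2}/x_degree big1 => [|j _]; last by rewrite ffunE.
apply/le_anti; have := hI _ cI; have := hJ _ cJ.
by rewrite !big1 // => -> ->.
Qed.

Lemma sum_fiber_degree_ge D A :
  nef D -> {in A, forall i, fiber_degree D i != 0} ->
  #|A|%:Z <= \sum_(i in A) fiber_degree D i.
Proof.
move=> /nefP[hI hJ] hA; rewrite -natz -sumr_const.
apply: ler_sum => i iA; have := sums_separated_ge0 hI hJ i; have := hA i iA.
by lia.
Qed.

Lemma nef_x_degree_lower_bound D : nef D -> ~ lin_equiv D 0 -> m%:Z <= x_degree D.
Proof.
move=> hD D0; have h1 := nef_at_most_one_zero_fiber hD D0.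
have [I IA cI] : exists2 I : {set yidx},
    I \subset ~: [set i | fiber_degree D i == 0] & #|I| = m.
  apply: sub_pick; have := cardsC [set i | fiber_degree D i == 0].
  by rewrite card_yidx; move: #|_| #|_| h1 => /=; lia.
rewrite -cI; apply: le_trans (proj1 (proj1 (nefP D) hD) I cI).
by apply: sum_fiber_degree_ge => // i /(subsetP IA); rewrite !inE.
Qed.

(** The index of a vanishing fiber degree, if any, is put into the set [J] whose
    sum bounds the [x_degree] from above; the remaining [n - m.+1] fiber degrees
    are then all positive. *)
Lemma nef_codegree_lower_bound D : nef D -> ~ lin_equiv D 0 ->
  (n - m.+1)%:Z <= \sum_i fiber_degree D i - x_degree D.
Proof.
move=> hD D0; have h1 := nef_at_most_one_zero_fiber hD D0.
have [] := @subset_card_between _ [set i | fiber_degree D i == 0] setT m.+1.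
- exact: subsetT.
- by rewrite cardsT card_yidx (leq_trans h1) //; lia.
move=> J [JA _ cJ].
have -> : (n - m.+1)%N = #|~: J|.
  by have := cardsC J; rewrite card_yidx cJ => nE; rewrite -[X in (X - _)%N]nE addKn.
have h2 : #|~: J|%:Z <= \sum_(i in ~: J) fiber_degree D i.
  apply: sum_fiber_degree_ge => // i; rewrite inE; apply: contra => i0.
  by apply: (subsetP JA); rewrite inE.
rewrite (bigID (mem J)) /=.
under [X in _ + X - _]eq_bigl do rewrite -in_setC.
rewrite addrAC -[leLHS]add0r lerD // subr_ge0.
exact: (proj2 (proj1 (nefP D) hD)).
Qed.


(** * Decompositions of the anticanonical class *)

Lemma degrees_anticanonical :
  (forall i, fiber_degree (anticanonical Z) i = 2) /\
  x_degree (anticanonical Z) = d.+1%:Z.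
Proof.
split=> [i|]; first by rewrite /fiber_degree !ffunE.
rewrite /x_degree; under eq_bigr do rewrite ffunE.
by rewrite sumr_const card_ord natz.
Qed.

Section Decompositions.
Variable K : numDomainType.

Lemma fiber_degree_scalar_ext D i :
  fiber_degree (scalar_ext K D) i = (fiber_degree D i)%:~R.
Proof. by rewrite /fiber_degree !ffunE rmorphD. Qed.

Lemma x_degree_scalar_ext D : x_degree (scalar_ext K D) = (x_degree D)%:~R.
Proof. by rewrite /x_degree rmorph_sum; apply: eq_bigr => j _; rewrite ffunE. Qed.

Variables (l : nat) (a : 'I_l -> K) (E : 'I_l -> divisor Z).
Let aE : {ffun ray Z -> K} := [ffun r => \sum_i a i * scalar_ext K (E i) r].

Lemma fiber_degree_comb i :
  fiber_degree aE i = \sum_k a k * (fiber_degree (E k) i)%:~R.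
Proof.
rewrite /fiber_degree !ffunE -big_split; apply: eq_bigr => k _ /=.
by rewrite !ffunE rmorphD mulrDr.
Qed.

Lemma x_degree_comb : x_degree aE = \sum_k a k * (x_degree (E k))%:~R.
Proof.
rewrite /x_degree; under eq_bigr do rewrite ffunE.
rewrite exchange_big; apply: eq_bigr => k _ /=.
by rewrite rmorph_sum mulr_sumr; apply: eq_bigr => j _; rewrite ffunE.
Qed.

End Decompositions.

(** Coefficients in a decomposition are positive, so an integral linear form on
    classes that is at least [N] on every summand is at least [N] times the total
    coefficient on the anticanonical class. *)
Lemma nef_decomposition_le_form (K : numDomainType) (al be N : int) (c : K) :
  (forall D, nef D -> ~ lin_equiv D 0 ->
     N <= al * x_degree D + be * \sum_i fiber_degree D i) ->
  nef_decomposition (anticanonical Z) c ->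
  c * N%:~R <= (al * d.+1%:Z + be * (2 * n)%:Z)%:~R.
Proof.
move=> hN [l [a [E [a0 hE /lin_equivP[hc hA] ->]]]].
have [c2 xd] := degrees_anticanonical.
have -> : (al * d.+1%:Z + be * (2 * n)%:Z)%:~R =
    \sum_k a k * (al * x_degree (E k) + be * \sum_i fiber_degree (E k) i)%:~R.
  rewrite rmorphD !rmorphM /= -xd -x_degree_scalar_ext hA x_degree_comb.
  have -> : (2 * n)%:Z%:~R = \sum_i \sum_k a k * (fiber_degree (E k) i)%:~R.
    under eq_bigr do rewrite -fiber_degree_comb -hc fiber_degree_scalar_ext c2.
    by rewrite sumr_const card_yidx -[LHS]/((2 * n)%:R) natrM mulr_natr.
  rewrite exchange_big /= !mulr_sumr -big_split /=; apply: eq_bigr => k _.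
  by rewrite -mulr_sumr rmorphD !rmorphM [X in _ = _ * (_ + _ * X)]rmorph_sum
             mulrDr /= ![a k * (_ * _)]mulrCA.
rewrite mulr_suml; apply: ler_sum => k _.
by rewrite ler_pM2l // ler_int; case: (hE k) => ? ?; apply: hN.
Qed.

Lemma nef_decomposition_le_x_degree (K : numDomainType) (c : K) :
  nef_decomposition (anticanonical Z) c -> c * m%:R <= d.+1%:R.
Proof.
move=> /(@nef_decomposition_le_form _ 1 0 m%:Z)-/(_ _)/le_trans.
rewrite mul1r mul0r addr0; apply => // D hD D0.
by rewrite mul1r mul0r addr0 nef_x_degree_lower_bound.
Qed.

Lemma nef_decomposition_le_codegree (K : numDomainType) (c : K) :
  nef_decomposition (anticanonical Z) c ->
  c * (n - m.+1)%:R <= (2 * n - d.+1)%:R.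
Proof.
move=> /(@nef_decomposition_le_form _ (-1) 1 (n - m.+1)%:Z)-/(_ _)/le_trans.
apply => [D hD D0|].
  by rewrite mulN1r mul1r addrC nef_codegree_lower_bound.
rewrite mulN1r mul1r addrC -natz -[d.+1%:Z]natz -natrB ?natz //; lia.
Qed.

Lemma nef_nontrivial_of_degrees c a :
  (forall I, #|I| = m -> \sum_(i in I) c i <= a) ->
  (forall J, #|J| = m.+1 -> a <= \sum_(i in J) c i) ->
  0 < a ->
  nef (divisor_of_degrees c a) /\ ~ lin_equiv (divisor_of_degrees c a) 0.
Proof.
move=> hI hJ a0; split; last first.
  case/lin_equivP => _; rewrite x_degree_of_degrees /x_degree big1 => [aE|j _].
    by rewrite aE ltxx in a0.
  by rewrite ffunE.
apply: nef_of_degrees => [I cI|J cJ]; rewrite x_degree_of_degrees.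
- by under eq_bigr do rewrite fiber_degree_of_degrees; apply: hI.
- by under eq_bigr do rewrite fiber_degree_of_degrees; apply: hJ.
Qed.

Lemma nef_decomposition_2 (K : numDomainType) :
  nef_decomposition (anticanonical Z) (2 : K).
Proof.
have e1 := leq_b1 e.
(* The [x_degree] of the two summands: they lie between [m] and [m.+1], and
   their sum is [d.+1]. *)
pose a (k : 'I_2) : nat := (m + (if k == ord0 then e : nat else 1))%N.
exists 2%N, (fun=> 1), (fun k => divisor_of_degrees (fun=> 1) (a k)%:Z).
split=> [k|k||]; first exact: ltr01.
- apply: nef_nontrivial_of_degrees => [I cI|J cJ|].
  + by rewrite sumr_const cI natz lez_nat leq_addr.
  + by rewrite sumr_const cJ natz lez_nat /a; case: ifP => _; lia.
  + by rewrite /a; lia.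
- have [c2 xd] := degrees_anticanonical.
  apply/lin_equivP; split=> [i|].
    rewrite fiber_degree_scalar_ext c2 fiber_degree_comb.
    rewrite big_ord_recl big_ord1 !fiber_degree_of_degrees mul1r; ring.
  rewrite x_degree_scalar_ext xd x_degree_comb big_ord_recl big_ord1.
  rewrite !x_degree_of_degrees !mul1r -rmorphD /= /a /=; congr (_%:~R); lia.
- by rewrite big_ord_recl big_ord1.
Qed.

(** One summand for each of the [d.+1] indices [k], all with coefficient [1 / m]:
    the indices [k >= n], which carry no ray [y_k], contribute the class with all
    fiber degrees 1.  A fiber degree of the sum is then [d / m], and this is 2
    only for [e = false]. *)
Lemma nef_decomposition_fano (K : numFieldType) :
  e = false -> nef_decomposition (anticanonical Z) (d.+1%:R / m%:R : K).
Proof.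
move=> e0; pose B (k : 'I_d.+1) : {set yidx} := [set i | val i == k].
have B1 k : (#|B k| <= 1)%N.
  apply/card_le1P => i; rewrite inE => /eqP ik i'.
  by rewrite !inE -ik (inj_eq val_inj).
pose c k i : int := (i \notin B k)%:R.
have sum_c k (A : {set yidx}) : \sum_(i in A) c k i = #|A :\: B k|%:Z.
  rewrite -natz -sumr_const big_mkcond [RHS]big_mkcond; apply: eq_bigr => i _.
  by rewrite in_setD /c; case: (i \in A); case: (i \in B k).
exists d.+1, (fun=> m%:R^-1), (fun k => divisor_of_degrees (c k) m%:Z).
have m0 : (m%:R : K) != 0 by rewrite pnatr_eq0 -lt0n.
have [c2 xd] := degrees_anticanonical.
split=> [k|k||].
- by rewrite invr_gt0 ltr0n.
- apply: nef_nontrivial_of_degrees => [I cI|J cJ|]; rewrite ?sum_c ?lez_nat //.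
    by rewrite (leq_trans (subset_leq_card (subsetDl _ _))) ?cI.
  rewrite cardsD cJ -ltnS.
  have : (#|J :&: B k| <= 1)%N.
    exact: leq_trans (subset_leq_card (subsetIr _ _)) (B1 k).
  by move: #|_|; lia.
- apply/lin_equivP; split=> [i|].
    rewrite fiber_degree_scalar_ext c2 fiber_degree_comb -mulr_sumr.
    have -> : \sum_(k < d.+1) (fiber_degree (divisor_of_degrees (c k) m) i)%:~R = d%:R :> K.
      rewrite (bigD1 (val i)) //= fiber_degree_of_degrees /c inE eqxx add0r.
      rewrite (eq_bigr (fun=> 1)) => [|k ki].
        by rewrite sumr_const cardC1 card_ord.
      by rewrite fiber_degree_of_degrees /c inE eq_sym ki.
    by rewrite e0 addn0 natrM mulrCA mulVf // mulr1.
  rewrite x_degree_scalar_ext xd x_degree_comb -mulr_sumr.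
  under eq_bigr do rewrite x_degree_of_degrees.
  by rewrite sumr_const card_ord mulrnAr mulVf.
- by rewrite sumr_const card_ord mulrC mulr_natr.
Qed.

End Classes.

(** * Gongyo indices *)

Lemma ereal_sup_eq_max (R : realType) (S : classical_sets.set (\bar R)) x :
  S x -> (forall y, S y -> (y <= x)%E) -> ereal_sup S = x.
Proof.
move=> Sx Sub; apply/le_anti/andP; split; last exact: ereal_sup_ubound.
exact: ge_ereal_sup.
Qed.

Lemma tauZ_eq (R : realType) d (X : fan d) (D : divisor X) (c : int) :
  nef_decomposition D c -> (forall b : int, nef_decomposition D b -> b <= c) ->
  tauZ R D = (c%:~R)%:E.
Proof.
move=> hc hb; apply: ereal_sup_eq_max; first by exists c.
by move=> _ [b hDb <-]; rewrite lee_fin ler_int hb.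
Qed.

Lemma tauQ_eq (R : realType) d (X : fan d) (D : divisor X) (c : rat) :
  nef_decomposition D c -> (forall b : rat, nef_decomposition D b -> b <= c) ->
  tauQ R D = (ratr c)%:E.
Proof.
move=> hc hb; apply: ereal_sup_eq_max; first by exists c.
by move=> _ [b hDb <-]; rewrite lee_fin ler_rat hb.
Qed.

Theorem theorem5p6 (R : realType) (e : bool) (m n : nat)
    (hm : (1 <= m)%N) (hd : (3 <= 2 * m + e)%N)
    (hn : (m + 2 <= n <= 2 * m + e + 1)%N) :
  (e = false -> (2 <= m)%N ->
     (tauZ R (anticanonical (Zfan e m n)), tauQ R (anticanonical (Zfan e m n)))
       = (2%:E, ((2 * m + 1)%:R / m%:R)%:E) /\
     delta R (anticanonical (Zfan e m n)) = (1 / m%:R)%:E) /\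
  (e = true ->
     (tauZ R (anticanonical (Zfan e m n)), tauQ R (anticanonical (Zfan e m n)))
       = (2%:E, 2%:E) /\
     delta R (anticanonical (Zfan e m n)) = 0%:E).
Proof.
split=> [e0 m2|e1].
  have tZ : tauZ R (anticanonical (Zfan e m n)) = 2%:E.
    apply: (@tauZ_eq R _ _ _ 2) => [|b hb]; first exact: nef_decomposition_2.
    rewrite leNgt; apply/negP => b3.
    have := nef_decomposition_le_x_degree hm hn hb.
    have : 3 * m%:R <= b * m%:R by rewrite ler_pM2r ?ltr0n //; lia.
    by rewrite e0 !natz; lia.
  have tQ : tauQ R (anticanonical (Zfan e m n)) = ((2 * m + 1)%:R / m%:R)%:E.
    have -> : ((2 * m + 1)%:R / m%:R : R) = ratr ((2 * m + e).+1%:R / m%:R).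
      by rewrite rmorph_div /= ?ratr_nat ?e0 ?addn0 ?addn1 // unitfE pnatr_eq0 -lt0n.
    apply: tauQ_eq => [|b hb]; first exact: nef_decomposition_fano.
    by rewrite ler_pdivlMr ?ltr0n //; apply: nef_decomposition_le_x_degree hb.
  split; first by rewrite tZ tQ.
  rewrite /delta tZ tQ -EFinB; congr (_%:E).
  have m0 : (m%:R : R) != 0 by rewrite pnatr_eq0 -lt0n.
  by rewrite natrD natrM; field.
have le2 (K : numDomainType) (b : K) :
    nef_decomposition (anticanonical (Zfan e m n)) b -> b <= 2.
  move/(nef_decomposition_le_codegree hm hn).
  have -> : (2 * n - (2 * m + e).+1 = 2 * (n - m.+1))%N by rewrite e1; lia.
  by rewrite natrM ler_pM2r // ltr0n; lia.
have tZ : tauZ R (anticanonical (Zfan e m n)) = 2%:E.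
  apply: (@tauZ_eq R _ _ _ 2) => [|b hb]; first exact: nef_decomposition_2.
  exact: le2.
have tQ : tauQ R (anticanonical (Zfan e m n)) = 2%:E.
  have -> : (2 : R) = ratr 2 by rewrite ratr_nat.
  by apply: tauQ_eq => [|b]; [apply: nef_decomposition_2 | apply: le2].
by rewrite /delta tZ tQ subee.
Qed.
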